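(* Let $F|k$ be a field extension with $F$ algebraically closed, and let $G_{F|k}=\mathrm{Aut}(F|k)$ with its compact-open topology. Then: (1) For every subfield $L$ with $k\subseteq L\subseteq F$, the group $\mathrm{Aut}(F|L)$ is a closed subgroup of $G_{F|k}$. For two such subfields $L_1,L_2$ one has $\mathrm{Aut}(F|L_1)=\mathrm{Aut}(F|L_2)$ if and only if $L_1^i=L_2^i$. Thus $L\mapsto\mathrm{Aut}(F|L)$ induces an injection from intermediate fields up to perfect equivalence into closed subgroups of $G_{F|k}$. (2) This map restricts to a bijection between intermediate fields $L$ with $\overline{L}=F$ (i.e. $F|L$ algebraic), up to perfect equivalence, and the compact subgroups of $G_{F|k}$. (3) It further restricts to a bijection between intermediate fields $L$ that are finitely generated over $k$ with $\overline{L}=F$, up to perfect equivalence, and the compact open subgroups of $G_{F|k}$.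
   Context: $G_{F|k}=\mathrm{Aut}(F|k)$ carries the compact-open topology for discrete $F$. A basis of open neighbourhoods of the identity is given by the subgroups $\mathrm{Aut}(F|K)$ with $K|k$ a finitely generated subextension of $F|k$. For a subfield $L\subseteq F$, its perfect closure $L^i$ is the set of elements of $F$ purely inseparable over $L$. Two subfields $L_1,L_2$ of $F$ are perfectly equivalent if $L_1^i=L_2^i$. *)

(* Defs.v *)
From Stdlib Require List.
From HB Require Import structures.
From mathcomp Require Import all_boot all_order all_algebra.
Set Implicit Arguments. Unset Strict Implicit. Unset Printing Implicit Defensive.
Import GRing.Theory.
Local Open Scope ring_scope.

Section FieldDefs.
Variable F : closedFieldType.

Definition set_eq {T : Type} (A B : T -> Prop) : Prop := forall x, A x <-> B x.
Definition subset {T : Type} (A B : T -> Prop) : Prop := forall x, A x -> B x.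

Definition is_subfield (L : F -> Prop) : Prop :=
  [/\ L 0, L 1,
      (forall x y, L x -> L y -> L (x - y)),
      (forall x y, L x -> L y -> L (x * y)) &
      (forall x, L x -> L (x^-1))].

Definition intermediate (k L : F -> Prop) : Prop := is_subfield L /\ subset k L.

(* perfect closure L^i : elements purely inseparable over L, i.e. x with
   x^(p^n) in L for some n, p the characteristic (x in L in char 0). *)
Definition perfect_closure (L : F -> Prop) : F -> Prop :=
  fun x => L x \/ exists (p n : nat), p \in [pchar F] /\ L (x ^+ (p ^ n)).

Definition algebraic_over (L : F -> Prop) (x : F) : Prop :=
  exists q : {poly F}, q != 0 /\ (forall i, L q`_i) /\ root q x.

Definition algebraic_ext (L : F -> Prop) : Prop := forall x, algebraic_over L x.

Definition generated (k : F -> Prop) (s : seq F) : F -> Prop :=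
  fun x => forall M, is_subfield M -> subset k M -> (forall y, y \in s -> M y) -> M x.

Definition fin_gen (k L : F -> Prop) : Prop :=
  exists s : seq F, set_eq L (generated k s).

Definition is_aut (f : F -> F) : Prop :=
  [/\ (forall x y, f (x + y) = f x + f y),
      (forall x y, f (x * y) = f x * f y),
      f 1 = 1 & bijective f].

Definition Aut (L : F -> Prop) : (F -> F) -> Prop :=
  fun f => is_aut f /\ (forall x, L x -> f x = x).

(* Topology on G = Aut(F|k): compact-open topology for discrete F, i.e.
   pointwise convergence. A subset U of G is open iff for every f in U there
   is a finite list s such that all g in G agreeing with f on s lie in U. *)
Definition G_open (k : F -> Prop) (U : (F -> F) -> Prop) : Prop :=
  subset U (Aut k) /\
  forall f, U f -> exists s : seq F,
    forall g, Aut k g -> (forall x, x \in s -> g x = f x) -> U g.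

Definition G_closed (k : F -> Prop) (H : (F -> F) -> Prop) : Prop :=
  subset H (Aut k) /\ G_open k (fun f => Aut k f /\ ~ H f).

Definition G_compact (k : F -> Prop) (H : (F -> F) -> Prop) : Prop :=
  subset H (Aut k) /\
  forall (I : Type) (C : I -> (F -> F) -> Prop),
    (forall i, G_open k (C i)) ->
    (forall f, H f -> exists i, C i f) ->
    exists l : list I, forall f, H f -> exists i, List.In i l /\ C i f.

Definition G_subgroup (k : F -> Prop) (H : (F -> F) -> Prop) : Prop :=
  [/\ subset H (Aut k), H id,
      (forall f g, H f -> H g -> H (f \o g)) &
      (forall f, H f -> exists g, H g /\ (forall x, g (f x) = x) /\ (forall x, f (g x) = x))].

End FieldDefs.

(* Main.v *)
Require Import Defs.
From HB Require Import structures.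
From mathcomp Require Import all_boot all_order all_algebra.
From mathcomp Require boolp classical_sets.
(** A partial embedding of F is encoded by its graph, an inverse-closed subring of the ring F * F on
which both projections have the same kernel; adjoining a pair (y, z) to such a graph extends the
embedding by y |-> z. By Zorn's lemma, first applied to graphs with equal domain and range and then
to all graphs, every partial automorphism of F extends to an automorphism, without a transcendence
basis. Hence the fixed field of Aut(F|L) is the perfect closure of L: a transcendental x is moved
to x + 1, and an algebraic x to another root of its minimal polynomial, there being one unless
(X - x)^m has coefficients in L for some m > 0.

For a compact subgroup H the orbits of polynomials over F under H are finite, so the product of the
T - q over the orbit of p in F[X] is a polynomial in T with coefficients fixed by H. For constant p
this makes F algebraic over the fixed field of H; in general it shows that an automorphism fixing
the latter agrees with an element of H on any given finite set, hence lies in H, as H is closed. *)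

Set Implicit Arguments. Unset Strict Implicit. Unset Printing Implicit Defensive.
Import GRing.Theory.
Local Open Scope ring_scope.

(** * Zorn's lemma for sets above a given one *)

Lemma set_eq_eq (T : Type) (A B : T -> Prop) : set_eq A B -> A = B.
Proof. by move=> AB; apply/boolp.funext => x; apply/boolp.propext. Qed.

(** [Zorn_bigcup] is applied to the sets X whose union with A0 satisfies P: the empty chain then
    yields A0, so only nonempty chains are left to the caller. *)
Lemma Zorn_above (T : Type) (P : (T -> Prop) -> Prop) (A0 : T -> Prop) :
  P A0 ->
  (forall C : (T -> Prop) -> Prop, (exists X, C X) -> (forall X, C X -> P X) ->
     (forall X Y, C X -> C Y -> Defs.subset X Y \/ Defs.subset Y X) ->
     P (fun x => exists2 X, C X & X x)) ->
  exists A, [/\ P A, Defs.subset A0 A &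
    forall B, P B -> Defs.subset A B -> Defs.subset B A].
Proof.
move=> PA0 chainP; pose U X := fun x : T => A0 x \/ X x.
have U0 X : Defs.subset A0 X -> U X = X.
  move=> A0X; apply: set_eq_eq => x; split=> [[/A0X|]//|]; by right.
have [C CP totC|A [PA maxA]] := @classical_sets.Zorn_bigcup T (fun X => P (U X)).
  have [nC|/boolp.contrapT[X0 CX0]] := boolp.EM (~ exists X, C X).
    suff -> : U (classical_sets.bigcup C id) = A0 by [].
    apply: set_eq_eq => x; split=> [[//|[X CX _]]|]; last by left.
    by case: nC; exists X.
  pose D Y := exists2 X, C X & Y = U X.
  suff -> : U (classical_sets.bigcup C id) = (fun x => exists2 X, D X & X x).
    apply: chainP.
    - by exists (U X0), X0.
    - by move=> _ [X CX ->]; apply: CP.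
    move=> _ _ [X CX ->] [Y CY ->].
    by have [XY|YX] := totC _ _ CX CY; [left|right] => x [|?]; try (by left);
       right; [apply: XY|apply: YX].
  apply: set_eq_eq => x; split.
    case=> [A0x|[X CX Xx]].
      by exists (U X0); [exists X0|left].
    by exists (U X); [exists X|right].
  by case=> _ [X CX ->] [A0x|Xx]; [left|right; exists X].
exists (U A); split=> // [x|B PB AB x Bx]; first by left.
have [Ax|nAx] := boolp.EM (A x); first by right.
case: (maxA B); last by rewrite U0 // => y A0y; apply: AB; left.
by split; [move=> y Ay; apply: AB; right | move/(_ x Bx)].
Qed.

(** * Inverse-closed subrings, polynomials over them, and adjunction of an element *)

Section InverseClosedSubrings.
Variable R : comUnitRingType.
Implicit Types (S : R -> Prop) (p q : {poly R}) (u x : R).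

(** Subfields of F and graphs in F * F are both instances. A non-unit is its own inverse, so the
    last condition bears on units only. *)
Record inv_subring S : Prop := InvSubring {
  inv_subring1 : S 1;
  inv_subringB : forall x y, S x -> S y -> S (x - y);
  inv_subringM : forall x y, S x -> S y -> S (x * y);
  inv_subringV : forall x, S x -> S x^-1 }.

Definition coefs_in S p := forall i, S p`_i.

Section Closure.
Variables (S : R -> Prop) (S_ok : inv_subring S).

Lemma inv_subring0 : S 0.
Proof. by rewrite -(subrr 1); apply: inv_subringB (inv_subring1 _) (inv_subring1 _). Qed.

Lemma inv_subringN x : S x -> S (- x).
Proof. by rewrite -sub0r; apply: inv_subringB S_ok _ _ inv_subring0. Qed.

Lemma inv_subringD x y : S x -> S y -> S (x + y).
Proof. by move=> Sx Sy; rewrite -[y]opprK; apply/(inv_subringB S_ok)/inv_subringN. Qed.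

Lemma inv_subringX x n : S x -> S (x ^+ n).
Proof.
move=> Sx; elim: n => [|n IH]; first by rewrite expr0; apply: inv_subring1.
by rewrite exprS; apply: inv_subringM.
Qed.

Lemma inv_subringMn x n : S x -> S (x *+ n).
Proof.
move=> Sx; elim: n => [|n IH]; first by rewrite mulr0n; apply: inv_subring0.
by rewrite mulrS; apply: inv_subringD.
Qed.

Lemma inv_subring_sum (I : Type) (r : seq I) (P : pred I) (E : I -> R) :
  (forall i, P i -> S (E i)) -> S (\sum_(i <- r | P i) E i).
Proof. by move=> SE; apply: big_ind => //; [apply: inv_subring0|apply: inv_subringD]. Qed.

Lemma coefs_inC x : S x -> coefs_in S x%:P.
Proof. by move=> Sx i; rewrite coefC; case: ifP => // _; apply: inv_subring0. Qed.

Lemma coefs_inX : coefs_in S 'X.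
Proof. by move=> i; rewrite coefX; case: (i == 1)%N; [apply: inv_subring1|apply: inv_subring0]. Qed.

Lemma coefs_inXn n : coefs_in S 'X^n.
Proof. by move=> i; rewrite coefXn; case: (i == n)%N; [apply: inv_subring1|apply: inv_subring0]. Qed.

Lemma coefs_inB p q : coefs_in S p -> coefs_in S q -> coefs_in S (p - q).
Proof. by move=> Sp Sq i; rewrite coefB; apply: inv_subringB. Qed.

Lemma coefs_inD p q : coefs_in S p -> coefs_in S q -> coefs_in S (p + q).
Proof. by move=> Sp Sq i; rewrite coefD; apply: inv_subringD. Qed.

Lemma coefs_inM p q : coefs_in S p -> coefs_in S q -> coefs_in S (p * q).
Proof. by move=> Sp Sq i; rewrite coefM; apply: inv_subring_sum => j _; apply: inv_subringM. Qed.

Lemma coefs_inZ x p : S x -> coefs_in S p -> coefs_in S (x *: p).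
Proof. by move=> Sx Sp i; rewrite coefZ; apply: inv_subringM. Qed.

Lemma inv_subring_horner p u : coefs_in S p -> S u -> S p.[u].
Proof.
move=> Sp Su; rewrite horner_coef; apply: inv_subring_sum => i _.
by apply: inv_subringM => //; apply: inv_subringX.
Qed.

(** Cancelling leading terms against a monic divisor needs no division of coefficients, hence stays
    in S and works over F * F in spite of its zero divisors. *)
Lemma monic_division p q : q \is monic -> coefs_in S p -> coefs_in S q ->
  exists d r, [/\ coefs_in S d, coefs_in S r, (size r < size q)%N & p = d * q + r].
Proof.
move=> mq Sp Sq; have [n] := ubnP (size p); elim: n => // n IH in p Sp *.
rewrite ltnS => szp; have [ltpq|leqp] := ltnP (size p) (size q).
  by exists 0, p; split; rewrite ?mul0r ?add0r //; apply/coefs_inC/inv_subring0.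
have q0 : (0 < size q)%N by rewrite size_poly_gt0 monic_neq0.
pose m := lead_coef p *: 'X^(size p - size q).
have Sm : coefs_in S m by apply: coefs_inZ; [apply: Sp|apply: coefs_inXn].
case: (IH (p - m * q)).
- by apply: coefs_inB => //; apply: coefs_inM.
- apply: leq_trans szp; have p0 := leq_trans q0 leqp.
  rewrite -[size p](prednK p0) ltnS; apply/leq_sizeP => j.
  rewrite coefB -scalerAl coefZ coefXnM => lej.
  have -> : (j < size p - size q)%N = false.
    apply/negbTE; rewrite -leqNgt; apply: leq_trans lej.
    by rewrite -subn1 leq_sub2l.
  have [ej|nj] := eqVneq j (size p).-1.
    have -> : (j - (size p - size q) = (size q).-1)%N.
      rewrite ej -!subn1 subnAC subKn //.
    by rewrite -[q`_ _]/(lead_coef q) (monicP mq) mulr1 ej subrr.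
  have ltj : (size p <= j)%N by rewrite -(prednK p0) ltn_neqAle eq_sym nj.
  rewrite nth_default // (@nth_default _ _ q) ?mulr0 ?subr0 //.
  by rewrite leq_subRL ?(leq_trans (leq_subr _ _)) // subnK.
move=> d [r [Sd Sr szr e]]; exists (m + d), r; split=> //.
  by apply: coefs_inD.
by rewrite mulrDl -addrA -e addrC subrK.
Qed.

End Closure.

(** Denominators are units, not just nonzero: over F * F neither component may vanish. *)
Definition adjoin S u : R -> Prop := fun w =>
  exists p q, [/\ coefs_in S p, coefs_in S q, q.[u] \is a GRing.unit & w = p.[u] / q.[u]].

Lemma adjoin_inv_subring S u : inv_subring S -> inv_subring (adjoin S u).
Proof.
move=> S_ok; have S1 := coefs_inC S_ok (inv_subring1 S_ok); split.
- by exists 1, 1; rewrite !hornerC unitr1 divr1.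
- move=> _ _ [p [q [Sp Sq uq ->]]] [p' [q' [Sp' Sq' uq' ->]]].
  exists (p * q' - p' * q), (q * q'); split; rewrite ?hornerM ?unitrM ?uq ?uq' //.
  + by apply: coefs_inB => //; apply: coefs_inM.
  + exact: coefs_inM.
  + rewrite hornerD hornerN !hornerM mulrBl invrM //; congr (_ - _).
      by rewrite mulrA mulrK.
    by rewrite (mulrC q'.[u]^-1) mulrA mulrK.
- move=> _ _ [p [q [Sp Sq uq ->]]] [p' [q' [Sp' Sq' uq' ->]]].
  exists (p * p'), (q * q'); split; rewrite ?hornerM ?unitrM ?uq ?uq' //; try exact: coefs_inM.
  by rewrite mulrACA invrM // (mulrC q'.[u]^-1).
move=> w [p [q [Sp Sq uq ->]]]; have [up|nup] := boolP (p.[u] \is a GRing.unit).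
  by exists q, p; split=> //; rewrite invrM ?unitrV // invrK mulrC.
(* If the numerator is not a unit, neither is the fraction, which is then its own inverse. *)
by rewrite invr_out ?unitrMl ?unitrV //; exists p, q.
Qed.

Lemma adjoin_sub S u x : inv_subring S -> S x -> adjoin S u x.
Proof.
move=> S_ok Sx; exists x%:P, 1; rewrite !hornerC unitr1 divr1; split=> //; apply: coefs_inC => //.
by case: S_ok.
Qed.

Lemma adjoin_gen S u : inv_subring S -> adjoin S u u.
Proof.
move=> S_ok; exists 'X, 1; rewrite hornerX hornerC unitr1 divr1; split=> //.
  exact: coefs_inX.
by rewrite -polyC1; apply: coefs_inC => //; case: S_ok.
Qed.

Lemma adjoin_min S T u : inv_subring T -> Defs.subset S T -> T u -> Defs.subset (adjoin S u) T.
Proof.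
move=> T_ok ST Tu _ [p [q [Sp Sq uq ->]]].
by apply: inv_subringM => //; [|apply: inv_subringV => //];
  apply: inv_subring_horner => // i; apply: ST.
Qed.

End InverseClosedSubrings.

(** * Partial isomorphisms of F and their extension *)

Section PartialIsomorphisms.
Variable F : closedFieldType.
Implicit Types (L : F -> Prop) (G : F * F -> Prop) (u v w : F * F) (P Q : {poly F * F}).

Lemma subfieldP L : is_subfield L <-> inv_subring L.
Proof.
split=> [[L0 L1 LB LM LV]|L_ok]; first by split.
by split; [apply: inv_subring0 L_ok|case: L_ok..].
Qed.

Lemma pair_unitE w : (w \is a GRing.unit) = (w.1 != 0) && (w.2 != 0).
Proof. by rewrite -!unitfE. Qed.

Lemma pair_invE w : w \is a GRing.unit -> w^-1 = (w.1^-1, w.2^-1).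
Proof. by move=> uw; rewrite {1}/GRing.inv /= /pair_invr ifT. Qed.

Lemma pair_divE w v : v \is a GRing.unit -> w / v = (w.1 / v.1, w.2 / v.2).
Proof. by move=> uv; rewrite pair_invE //. Qed.

Definition partial_iso G := inv_subring G /\ forall w, G w -> (w.1 == 0) = (w.2 == 0).

Definition pdom G : F -> Prop := fun a => exists b, G (a, b).
Definition pran G : F -> Prop := fun b => exists a, G (a, b).
(** Among partial isomorphisms this singles out the automorphisms of subfields. *)
Definition balanced G := forall a, pdom G a <-> pran G a.
Definition pswap G : F * F -> Prop := fun w => G (w.2, w.1).

Lemma partial_iso_swap G : partial_iso G -> partial_iso (pswap G).
Proof.
case=> G_ok G0; split; last by move=> w /G0 ->.
split; rewrite /pswap.
- by apply: inv_subring1 G_ok.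
- by move=> x y Gx /(inv_subringB G_ok Gx).
- by move=> x y Gx /(inv_subringM G_ok Gx).
move=> x /(inv_subringV G_ok); have [ux|nux] := boolP (x \is a GRing.unit).
  by rewrite !pair_invE // pair_unitE andbC -pair_unitE.
by rewrite !invr_out // pair_unitE andbC -pair_unitE.
Qed.

Lemma pdom_subring G : partial_iso G -> inv_subring (pdom G).
Proof.
case=> G_ok G0; split.
- by exists 1; apply: inv_subring1 G_ok.
- by move=> x y [x' Gx] [y' Gy]; exists (x' - y'); apply: inv_subringB G_ok _ _ Gx Gy.
- by move=> x y [x' Gx] [y' Gy]; exists (x' * y'); apply: inv_subringM G_ok _ _ Gx Gy.
move=> x [x' Gx]; have := G0 _ Gx; have := inv_subringV G_ok Gx; move=> /=.
have [-> _ _|x0] := eqVneq x 0.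
  by rewrite invr0; exists 0; apply: inv_subring0 G_ok.
rewrite pair_invE; last first.
  rewrite pair_unitE /= x0; case: eqP => // e; move: (G0 _ Gx).
  by rewrite /= e eqxx (negbTE x0).
by move=> GV _; exists x'^-1.
Qed.

Lemma pran_subring G : partial_iso G -> inv_subring (pran G).
Proof. by move/partial_iso_swap/pdom_subring. Qed.

Lemma inv_subring_fst L : inv_subring L -> inv_subring (fun w : F * F => L w.1).
Proof.
case=> L1 LB LM LV; split=> //= [x y|x y|x]; [exact: LB|exact: LM|].
have [ux|nux] := boolP (x \is a GRing.unit); last by rewrite invr_out.
by rewrite pair_invE //; apply: LV.
Qed.

Lemma inv_subring_snd L : inv_subring L -> inv_subring (fun w : F * F => L w.2).
Proof.
case=> L1 LB LM LV; split=> //= [x y|x y|x]; [exact: LB|exact: LM|].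
have [ux|nux] := boolP (x \is a GRing.unit); last by rewrite invr_out.
by rewrite pair_invE //; apply: LV.
Qed.

Lemma partial_iso_eq0 G w : partial_iso G -> G w -> w.1 = 0 -> w = 0.
Proof.
by case=> _ G0 /G0; case: w => a b /= e a0; move: e; rewrite a0 eqxx => /esym/eqP ->.
Qed.

Lemma partial_iso_unit G w : partial_iso G -> G w -> w != 0 -> w \is a GRing.unit.
Proof.
move=> G_ok Gw; rewrite pair_unitE -(G_ok.2 _ Gw) andbb; apply: contraNneq => w0.
exact/eqP/(partial_iso_eq0 G_ok Gw).
Qed.

Lemma partial_iso_fun G a b b' : partial_iso G -> G (a, b) -> G (a, b') -> b = b'.
Proof.
move=> G_ok Gb Gb'; have := partial_iso_eq0 G_ok (inv_subringB G_ok.1 Gb Gb').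
by rewrite /= subrr => /(_ erefl) [] _ /eqP; rewrite subr_eq0 => /eqP.
Qed.

Lemma partial_iso_inj G a a' b : partial_iso G -> G (a, b) -> G (a', b) -> a = a'.
Proof. by move/partial_iso_swap; apply: partial_iso_fun. Qed.

Lemma horner_fst P u : P.[u].1 = (map_poly fst P).[u.1].
Proof. by rewrite horner_map. Qed.

Lemma horner_snd P u : P.[u].2 = (map_poly snd P).[u.2].
Proof. by rewrite horner_map. Qed.

(** Elements of the extension are fractions whose denominators vanish in neither component, so only
    the numerators need testing. *)
Lemma partial_iso_adjoin G u : partial_iso G ->
  (forall P, coefs_in G P -> (P.[u].1 == 0) = (P.[u].2 == 0)) -> partial_iso (adjoin G u).
Proof.
move=> [G_ok G0] Gu; split; first exact: adjoin_inv_subring.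
move=> _ [p [q [Gp Gq uq ->]]]; rewrite pair_divE //=.
move: uq; rewrite pair_unitE => /andP[/negbTE q1 /negbTE q2].
by rewrite !mulf_eq0 !invr_eq0 q1 q2 !orbF Gu.
Qed.

Definition diag L : F * F -> Prop := fun w => L w.1 /\ w.1 = w.2.

Lemma diag_partial_iso L : inv_subring L -> partial_iso (diag L).
Proof.
case=> L1 LB LM LV; split; last by move=> w [_ ->].
split; rewrite /diag.
- by [].
- by move=> x y [Lx ex] [Ly ey] /=; rewrite -ex -ey; split; [apply: LB|].
- by move=> x y [Lx ex] [Ly ey] /=; rewrite -ex -ey; split; [apply: LM|].
move=> x [Lx ex]; have [ux|nux] := boolP (x \is a GRing.unit); last by rewrite invr_out.
by rewrite pair_invE //= -ex; split; [apply: LV|].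
Qed.

(** The flag [b] serves both uses of Zorn's lemma: [True] maximises among balanced graphs, [False]
    among all. Any two elements of the union of a chain lie in one member, which gives the closure
    conditions. *)
Lemma maximal_partial_iso (b : Prop) G0 : partial_iso G0 -> (b -> balanced G0) ->
  exists G, [/\ partial_iso G, b -> balanced G, Defs.subset G0 G &
    forall G', partial_iso G' -> (b -> balanced G') -> Defs.subset G G' -> Defs.subset G' G].
Proof.
move=> G0_ok bal0.
have [|C [X0 CX0] CP totC|G [[G_ok bal] G0G maxG]] :=
    @Zorn_above _ (fun G => partial_iso G /\ (b -> balanced G)) G0; first by [].
  split; last first.
    by move=> hb a; split=> -[c [X CX Xac]]; have [_ /(_ hb a)[h1 h2]] := CP X CX;
      [have [|d Xd] := h1|have [|d Xd] := h2]; try (by exists c); exists d, X.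
  split; last by move=> w [X CX Xw]; apply: (CP X CX).1.2.
  have both x y : (exists2 X, C X & X x) -> (exists2 X, C X & X y) ->
      exists X, [/\ C X, X x & X y].
    move=> [X CX Xx] [Y CY Yy].
    by have [XY|YX] := totC _ _ CX CY; [exists Y|exists X]; split=> //; [apply: XY|apply: YX].
  split.
  - by exists X0 => //; apply: inv_subring1 (CP X0 CX0).1.1.
  - move=> x y Cx Cy; have [X [CX Xx Xy]] := both _ _ Cx Cy.
    by exists X => //; apply: inv_subringB (CP X CX).1.1 _ _ Xx Xy.
  - move=> x y Cx Cy; have [X [CX Xx Xy]] := both _ _ Cx Cy.
    by exists X => //; apply: inv_subringM (CP X CX).1.1 _ _ Xx Xy.
  by move=> x [X CX Xx]; exists X => //; apply: inv_subringV (CP X CX).1.1 _ Xx.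
by exists G; split=> // G' G'_ok bal'; apply: maxG.
Qed.

(** A polynomial over G amounts to a polynomial over the domain paired with its image under the
    embedding. *)
Lemma coefs_in_lift G p : partial_iso G -> coefs_in (pdom G) p ->
  exists P, coefs_in G P /\ map_poly fst P = p.
Proof.
move=> G_ok Gp; have [b Gb] := boolp.choice Gp.
exists (\poly_(i < size p) (p`_i, b i)); split.
  move=> i; rewrite coef_poly; case: ifP => // _; exact: inv_subring0 G_ok.1.
apply/polyP => i; rewrite coef_map coef_poly; case: ltnP => //= lei.
by rewrite nth_default.
Qed.

(** By the kernel condition a nonzero element of G is nonzero in both components, so the leading
    coefficient is a unit. *)
Lemma partial_iso_monic G P : partial_iso G -> coefs_in G P -> P != 0 ->
  exists c, [/\ c \is a GRing.unit, coefs_in G (c *: P), c *: P \is monic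
              & size (c *: P) = size P].
Proof.
move=> G_ok GP P0; have ul : lead_coef P \is a GRing.unit.
  by apply: (partial_iso_unit G_ok); rewrite ?lead_coef_eq0 //; apply: GP.
have rl : GRing.lreg (lead_coef P)^-1 by apply: mulrI; rewrite unitrV.
exists (lead_coef P)^-1; rewrite unitrV; split=> //.
- apply: coefs_inZ => //; first by case: G_ok.
  by apply: inv_subringV; [case: G_ok|apply: GP].
- by rewrite monicE (lead_coef_lreg _ rl) mulVr.
- exact: (lreg_size _ rl).
Qed.

Lemma monic_size_le1 (R : nzRingType) (p : {poly R}) : p \is monic -> (size p <= 1)%N -> p = 1.
Proof.
by move=> mp /size1_polyC e; move: mp; rewrite e monicE lead_coefC => /eqP ->.
Qed.

(* The first projections of a minimal monic Q generate the ideal of polynomials vanishing at y;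
   any root z of the second projection of Q is a legitimate image of y. *)
Lemma partial_iso_simple G y : partial_iso G -> algebraic_over (pdom G) y ->
  exists Q, [/\ coefs_in G Q, Q \is monic, root (map_poly fst Q) y &
    forall z, root (map_poly snd Q) z -> partial_iso (adjoin G (y, z))].
Proof.
move=> G_ok [q [q0 [Gq rq]]].
pose van n := boolp.asbool (exists Q, [/\ coefs_in G Q, size Q = n, Q != 0 &
  (map_poly fst Q).[y] = 0]).
have ex_van : exists n, van n.
  have [P [GP eP]] := coefs_in_lift G_ok Gq; exists (size P); apply/boolp.asboolP.
  exists P; split=> //; last by rewrite eP; apply/rootP.
  by apply: contraNneq q0 => P0; rewrite -eP P0 rmorph0.
have [n /boolp.asboolP[Q0 [GQ0 szQ0 Q00 Q0y]] min_n] := ex_minnP ex_van.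
have [c [uc GQ mQ szQ]] := partial_iso_monic G_ok GQ0 Q00.
have {Q0y}Qy : (map_poly fst (c *: Q0)).[y] = 0.
  by rewrite -mul_polyC rmorphM /= hornerM Q0y mulr0.
have {szQ0}szQ : size (c *: Q0) = n by rewrite szQ.
move: (c *: Q0) GQ mQ szQ Qy => {Q0 GQ0 Q00 c uc} Q GQ mQ szQ Qy.
have Q_min P : coefs_in G P -> (size P < n)%N -> (map_poly fst P).[y] = 0 -> P = 0.
  move=> GP; rewrite ltnNge => /negP ltPn Py; apply/eqP/negP => /negP P0; apply: ltPn.
  by apply: min_n; apply/boolp.asboolP; exists P.
exists Q; split=> // [|z /rootP Qz]; first exact/rootP.
have Qu : Q.[(y, z)] = 0.
  by rewrite [Q.[_]]surjective_pairing horner_fst horner_snd /= Qy Qz.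
(* Induction on the size: dividing Q by a monic P that vanishes at z leaves a shorter remainder
   vanishing at z, hence zero, and Q = d P. One factor vanishes at y, against the minimality of Q:
   both are nonzero, and shorter than Q since P is not constant. *)
have Q_min2 P : coefs_in G P -> (size P < n)%N -> P.[(y, z)].2 = 0 -> P = 0.
  have [m] := ubnP (size P); elim: m => // m IH in P *.
  rewrite ltnS => szP GP ltPn Pz; apply/eqP/negP => /negP P0.
  have [c [uc GP' mP szP']] := partial_iso_monic G_ok GP P0.
  have {Pz} : (c *: P).[(y, z)].2 = 0 by rewrite hornerZ /= Pz mulr0.
  rewrite -szP' in szP ltPn; move: (c *: P) GP' mP szP ltPn.
  move=> {P GP P0 c uc szP'} P GP mP szP ltPn Pz.
  have [d [r [Gd Gr szr Qdr]]] := monic_division G_ok.1 mP GQ GP.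
  have r0 : r = 0.
    apply: IH => //; first exact: leq_trans szr szP.
      exact: ltn_trans szr ltPn.
    have : Q.[(y, z)].2 = 0 by rewrite Qu.
    by rewrite Qdr hornerD hornerM /= Pz mulr0 add0r.
  have eQ : Q = d * P by rewrite Qdr r0 addr0.
  have /eqP : (map_poly fst d).[y] * (map_poly fst P).[y] = 0.
    by rewrite -hornerM -rmorphM -eQ.
  rewrite mulf_eq0 => /orP[]/eqP dP0; last first.
    by move: (monic_neq0 mP); rewrite (Q_min P) // eqxx.
  have d0 : d != 0.
    apply: contraTneq mQ => d0.
    by rewrite eQ d0 mul0r monicE lead_coef0 eq_sym oner_neq0.
  have szP1 : (1 < size P)%N.
    rewrite ltnNge; apply/negP => szP1.
    have P1 : P = 1 by apply: monic_size_le1.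
    by move: Pz; rewrite P1 hornerC => /eqP; rewrite oner_eq0.
  apply/negP: (d0); rewrite negbK; apply/eqP/Q_min => //.
  rewrite -szQ eQ size_Mmonic // -subn1 -addnBA ?(ltnW szP1) //.
  by rewrite -[X in (X < _)%N]addn0 ltn_add2l subn_gt0.
(* Modulo Q, P becomes a remainder too short to vanish at y or at z unless it is zero. *)
apply: partial_iso_adjoin => // P GP.
have [d [r [Gd Gr szr ->]]] := monic_division G_ok.1 mQ GP GQ.
rewrite szQ in szr; rewrite hornerD hornerM Qu mulr0 add0r.
apply/eqP/eqP => [r1|r2]; last by rewrite (Q_min2 r) // horner0.
by rewrite (Q_min r) ?horner0 // -[y]/((y, z).1) -horner_fst.
Qed.

(** As F is algebraically closed, the second projection of Q has a root z, and (y, z) can be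
    adjoined to G. *)
Lemma pdom_maximal G : partial_iso G ->
    (forall G', partial_iso G' -> Defs.subset G G' -> Defs.subset G' G) ->
  forall y, algebraic_over (pdom G) y -> pdom G y.
Proof.
move=> G_ok maxG y /(partial_iso_simple G_ok)[Q [_ mQ Qy adj]].
have [|z /adj adj_z] := @closed_rootP _ (map_poly snd Q) _.
  (* Q being monic, both projections have its size; were it 1, the first would be a nonzero constant
     vanishing at y. *)
  apply/negP => /eqP sz1; have /eqP/size_poly1P[c c0 ec] : size (map_poly fst Q) = 1%N.
    by apply: etrans sz1; rewrite !size_map_poly_id0 // (monicP mQ) oner_neq0.
  by move: Qy; rewrite ec rootC (negbTE c0).
exists z; apply: (maxG _ adj_z _ (y, z)); last by apply: adjoin_gen G_ok.1.
by move=> w; apply: adjoin_sub G_ok.1.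
Qed.

Lemma rmorphism_of (f : F -> F) : {morph f : x y / x + y} -> {morph f : x y / x * y} -> f 1 = 1 ->
  exists phi : {rmorphism F -> F}, f = phi.
Proof.
move=> fD fM f1; have f0 : f 0 = 0 by apply: (addIr (f 0)); rewrite -fD !add0r.
pose fN := GRing.isNmodMorphism.Build F F f (f0, fD).
pose fR := GRing.isMonoidMorphism.Build F F f (f1, fM).
pose phi : {rmorphism F -> F} := HB.pack f fN fR.
by exists phi.
Qed.

Lemma is_aut_surjective (phi : {rmorphism F -> F}) : (forall y, exists x, phi x = y) -> is_aut phi.
Proof.
move=> /boolp.choice[g gK]; split; [exact: rmorphD|exact: rmorphM|exact: rmorph1|].
by exists g => // x; apply: (fmorph_inj phi); rewrite gK.
Qed.

Lemma algebraic_overS L L' x : Defs.subset L L' -> algebraic_over L x -> algebraic_over L' x.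
Proof. by move=> LL' [q [q0 [Lq rq]]]; exists q; split=> //; split=> // i; apply: LL'. Qed.

(** F is algebraic over the domain of a maximal balanced G, since otherwise a transcendental y could
    be adjoined by (y, y). A graph G1 above G, maximal among all graphs, then has domain F. *)
Lemma balanced_extends G0 : partial_iso G0 -> balanced G0 ->
  exists f, is_aut f /\ forall w, G0 w -> f w.1 = w.2.
Proof.
move=> G0_ok bal0.
have [G [G_ok bal G0G maxG]] := maximal_partial_iso (b := True) G0_ok (fun=> bal0).
move: bal => /(_ I) bal.
have G_alg y : algebraic_over (pdom G) y.
  apply: boolp.contrapT => nalg.
  have van0 q : coefs_in (pdom G) q -> q.[y] = 0 -> q = 0.
    move=> Gq qy; apply/eqP/negP => /negP q0; apply: nalg; exists q; split=> //.
    by split=> //; apply/rootP.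
  (* As domain and range agree, y is transcendental over both: a projection of P vanishes at y only
     if all its coefficients are zero, and these vanish in both components at once. *)
  have adj : partial_iso (adjoin G (y, y)).
    apply: partial_iso_adjoin => // P GP; rewrite horner_fst horner_snd /=.
    have P_eq0 i : (P`_i).1 = 0 <-> (P`_i).2 = 0.
      by have e := G_ok.2 _ (GP i); split=> /eqP; [rewrite e|rewrite -e] => /eqP.
    have G1 : coefs_in (pdom G) (map_poly fst P).
      by move=> i; rewrite coef_map /=; exists (P`_i).2; rewrite -surjective_pairing.
    have G2 : coefs_in (pdom G) (map_poly snd P).
      by move=> i; rewrite coef_map /=; apply/bal; exists (P`_i).1; rewrite -surjective_pairing.
    apply/eqP/eqP => [/(van0 _ G1)|/(van0 _ G2)] /polyP e.
      rewrite (_ : map_poly snd P = 0) ?horner0 //; apply/polyP => i.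
      by rewrite coef_map coef0 /=; apply/P_eq0; move: (e i); rewrite coef_map coef0.
    rewrite (_ : map_poly fst P = 0) ?horner0 //; apply/polyP => i.
    by rewrite coef_map coef0 /=; apply/P_eq0; move: (e i); rewrite coef_map coef0.
  have subG : Defs.subset G (adjoin G (y, y)) by move=> w; apply: adjoin_sub G_ok.1.
  have yy : adjoin G (y, y) (y, y) by apply: adjoin_gen G_ok.1.
  have Gyy : G (y, y).
    apply: (maxG _ adj) => // _ a; split=> -[c ac].
      apply: (adjoin_min (inv_subring_fst (pran_subring adj)) _ _ ac); last by exists y.
      move=> [a' c'] Gac.
      by have [|d Gd] := (bal a').1; [exists c'|exists d; apply: subG].
    apply: (adjoin_min (inv_subring_snd (pdom_subring adj)) _ _ ac); last by exists y.
      move=> [a' c'] Gac.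
    by have [|d Gd] := (bal c').2; [exists a'|exists d; apply: subG].
  apply: nalg; exists ('X - y%:P); rewrite polyXsubC_eq0; split=> //.
  split; last by rewrite root_XsubC.
  have dom_ok := pdom_subring G_ok.
  by apply: coefs_inB => //; [apply: coefs_inX|apply: coefs_inC => //; exists y].
have [G1 [G1_ok _ GG1 maxG1]] := maximal_partial_iso (b := False) G_ok (fun h => False_ind _ h).
have /boolp.choice[f fE] : forall a, pdom G1 a.
  move=> a; apply: pdom_maximal => // [G' G'_ok|]; first by apply: maxG1.
  by apply: algebraic_overS (G_alg a) => b [c Gbc]; exists c; apply: GG1.
have f_eq a b : G1 (a, b) -> f a = b by apply: partial_iso_fun G1_ok _.
have [phi ephi] : exists phi : {rmorphism F -> F}, f = phi.
  apply: rmorphism_of => [a b|a b|]; apply: f_eq.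
  - by have := inv_subringD G1_ok.1 (fE a) (fE b).
  - by have := inv_subringM G1_ok.1 (fE a) (fE b).
  - exact: inv_subring1 G1_ok.1.
exists f; split; last by move=> [a b] Gab; apply/f_eq/GG1/G0G.
rewrite ephi; apply: is_aut_surjective => y.
(* Surjectivity: q has coefficients in the range of G, so it is the image of a polynomial that
   splits over F, and the roots of the latter are mapped onto those of q. *)
have [q [q0 [Gq rq]]] := G_alg y.
have [|P [GP eP]] := coefs_in_lift (partial_iso_swap G_ok) (p := q).
  by move=> i; apply/bal.
have eq : map_poly phi (map_poly snd P) = q.
  rewrite -eP; apply/polyP => i; rewrite !coef_map /= -ephi; apply/f_eq/GG1/GP.
have [rs ers] := closed_field_poly_normal (map_poly snd P).
move: rq q0; rewrite -eq ers map_polyZ rmorph_prod /= => rq.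
rewrite scaler_eq0 negb_or => /andP[lc0 _]; move: rq.
under eq_bigr do rewrite map_polyXsubC.
by rewrite rootZ // -(big_map phi predT (fun a => 'X - a%:P)) root_prod_XsubC =>
  /mapP[x _ ->]; exists x.
Qed.
End PartialIsomorphisms.

(** * Conjugates and the fixed field of Aut(F|L) *)

Lemma inj_stable_surj (T : eqType) (s : seq T) (g : T -> T) :
  {in s &, injective g} -> {in s, forall x, g x \in s} ->
  {in s, forall y, exists2 x, x \in s & g x = y}.
Proof.
move=> inj_g gs y sy; pose t := undup s.
have ut : uniq (map g t).
  by rewrite map_inj_in_uniq ?undup_uniq // => a b; rewrite !mem_undup; apply: inj_g.
have st : {subset map g t <= t}.
  by move=> _ /mapP[a + ->]; rewrite !mem_undup; apply: gs.
have [|_ /(_ y)] := uniq_min_size ut st; first by rewrite size_map.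
by rewrite mem_undup sy => /mapP[x + ->]; rewrite mem_undup; exists x.
Qed.

Section Conjugates.
Variable F : closedFieldType.
Implicit Types (L : F -> Prop) (G : F * F -> Prop) (x y z : F).

(** The coefficient of degree N(m - 1) is -mc, and m is invertible in F. *)
Lemma coefs_in_Xn_subC_exp L c N m : inv_subring L -> (0 < N)%N -> m%:R != 0 :> F ->
  coefs_in L (('X^N - c%:P) ^+ m) -> L c.
Proof.
move=> L_ok N0 m0 Lc; have m1 : (0 < m)%N by case: m m0 {Lc}; rewrite ?eqxx.
have : L ((('X - c%:P) ^+ m)`_m.-1).
  have := Lc (m.-1 * N)%N; rewrite (_ : _ ^+ m = ('X - c%:P) ^+ m \Po 'X^N).
    by rewrite coef_comp_poly_Xn // dvdn_mull // mulnK.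
  by rewrite rmorphXn /= comp_polyB comp_polyX comp_polyC.
rewrite (_ : _ ^+ m = \prod_(z <- nseq m c) ('X - z%:P)); last first.
  by rewrite big_nseq iter_mulr_1.
have {2}-> : m = size (nseq m c) by rewrite size_nseq.
rewrite coefPn_prod_XsubC ?size_nseq -?lt0n // big_nseq iter_addr_0.
move/(inv_subringN L_ok); rewrite opprK -mulr_natr => Lcm.
rewrite -(mulfK m0 c); apply: inv_subringM => //; apply: inv_subringV => //.
by rewrite -[X in L X]/(1 *+ m); apply: inv_subringMn => //; case: L_ok.
Qed.

(** In characteristic p write m = N m' with N the exact power of p dividing m: then (X - x)^m = (X^N
    - x^N)^m' and m' is nonzero in F. In characteristic 0 take N = 1. *)
Lemma perfect_closure_XsubC_exp L x m : inv_subring L -> (0 < m)%N ->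
  coefs_in L (('X - x%:P) ^+ m) -> perfect_closure L x.
Proof.
move=> L_ok m0 Lx; have [[p charp]|nchar] := boolp.EM (exists p, p \in [pchar F]); last first.
  left; apply: (@coefs_in_Xn_subC_exp _ _ 1 m) => //.
  by apply: contra_notN nchar; apply: natf0_pchar.
have p_pr := pcharf_prime charp; set e := logn p m; set N := (p ^ e)%N.
have N0 : (0 < N)%N by rewrite expn_gt0 prime_gt0.
have Nm : (m %/ N * N)%N = m by rewrite divnK // pfactor_dvdnn.
have charN : [pchar {poly F}].-nat N.
  by rewrite pnatX pnatE // pchar_poly charp.
right; exists p, e; split=> //.
(* By additivity (X - x)^N = X^N + (-x)^N; keeping the constant in this form spares a discussion of
   the parity of N. *)
suff : L (- (- x) ^+ N).
  move/(inv_subringN L_ok); rewrite opprK exprNn => LN.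
  rewrite -[x ^+ _](signrMK N).
  apply: inv_subringM => //; apply: inv_subringX => //; apply: inv_subringN => //.
  by case: L_ok.
apply: (@coefs_in_Xn_subC_exp _ _ N (m %/ N)) => //.
  rewrite -(dvdn_pcharf charp); apply/negP => /dvdnP[d ed].
  have : (p ^ e.+1 %| m)%N by rewrite -Nm ed -mulnA -expnS dvdn_mull.
  by rewrite pfactor_dvdn // ltnn.
by rewrite polyCN opprK polyC_exp -exprDn_pchar // polyCN -exprM mulnC Nm.
Qed.

Lemma coefs_in_comp L p q : inv_subring L -> coefs_in L p -> coefs_in L q -> coefs_in L (p \Po q).
Proof.
move=> L_ok Lp Lq; rewrite comp_polyE; apply: (big_ind (coefs_in L)).
- by rewrite -polyC0; apply: coefs_inC => //; apply: inv_subring0.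
- by move=> a b; apply: coefs_inD.
move=> i _; apply: coefs_inZ => //; elim: (i : nat) => [|n IH].
  by rewrite expr0 -polyC1; apply: coefs_inC => //; case: L_ok.
by rewrite exprS; apply: coefs_inM.
Qed.

Lemma partial_iso_root G P u : partial_iso G -> coefs_in G P -> G u ->
  root (map_poly fst P) u.1 -> root (map_poly snd P) u.2.
Proof.
move=> G_ok GP Gu; rewrite !rootE -horner_fst -horner_snd G_ok.2 //.
by apply: inv_subring_horner; case: G_ok.
Qed.

Lemma diag_fst_snd L P : coefs_in (diag L) P -> map_poly fst P = map_poly snd P.
Proof. by move=> LP; apply/polyP => i; rewrite !coef_map /=; have [] := LP i. Qed.

(** If P vanishes at x + 1, then P(X + 1) vanishes at x, so it is zero and so is P. As L(x + 1) =
    L(x), the map x |-> x + 1 defines an automorphism of L(x), which extends to F. *)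
Lemma transcendental_moved L x : inv_subring L -> ~ algebraic_over L x ->
  exists f, Aut L f /\ f x <> x.
Proof.
move=> L_ok nalg; pose u := (x, x + 1).
have van0 q : coefs_in L q -> q.[x] = 0 -> q = 0.
  move=> Gq qx; apply/eqP/negP => /negP q0; apply: nalg; exists q; split=> //.
  by split=> //; apply/rootP.
have adj : partial_iso (adjoin (diag L) u).
  apply: partial_iso_adjoin => [|P LP]; first exact: diag_partial_iso.
  rewrite horner_fst horner_snd -(diag_fst_snd LP) /=.
  have Lp : coefs_in L (map_poly fst P) by move=> i; rewrite coef_map; case: (LP i).
  apply/eqP/eqP => [/(van0 _ Lp) ->|]; first by rewrite horner0.
  have L1 : L 1 by case: L_ok.
  have Lp1 : coefs_in L (map_poly fst P \Po ('X + 1%:P)).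
    by apply: coefs_in_comp => //; apply: coefs_inD => //; [apply: coefs_inX|apply: coefs_inC].
  have -> : x + 1 = ('X + 1%:P).[x] by rewrite !hornerE.
  rewrite -horner_comp => /(van0 _ Lp1) e.
  by rewrite -[map_poly _ _](comp_polyXaddC_K _ 1) e comp_poly0 horner0.
have diag_adj a : L a -> adjoin (diag L) u (a, a).
  by move=> La; apply: adjoin_sub; [case: (diag_partial_iso L_ok)|].
have adj_u : adjoin (diag L) u u by apply: adjoin_gen; case: (diag_partial_iso L_ok).
have [dom_ok ran_ok] := (pdom_subring adj, pran_subring adj).
have bal : balanced (adjoin (diag L) u).
  move=> a; split=> -[b ab].
    apply: (adjoin_min (inv_subring_fst ran_ok) _ _ ab) => [[a' c'] [/= La' _]|/=].
      by exists a'; apply: diag_adj.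
    rewrite -(addrK 1 x); apply: inv_subringB => //; last by case: ran_ok.
    by exists x.
  apply: (adjoin_min (inv_subring_snd dom_ok) _ _ ab) => [[a' c'] [/= La' <-]|/=].
    by exists a'; apply: diag_adj.
  apply: inv_subringD => //; last by case: dom_ok.
  by exists (x + 1).
have [f [f_aut fE]] := balanced_extends adj bal.
exists f; split; first by split=> // a /diag_adj/fE.
have -> : f x = x + 1 := fE _ adj_u.
by move/eqP; rewrite -subr_eq0 addrAC subrr add0r oner_eq0.
Qed.

Lemma generated_subfield L (s : seq F) : is_subfield (generated L s).
Proof.
split=> [M []//|M []//|a b La Lb M M_ok LM sM|a b La Lb M M_ok LM sM|a La M M_ok LM sM];
  case: (M_ok) => M0 M1 MB MM MV; [apply: MB|apply: MM|apply: MV];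
  by [apply: La|apply: Lb].
Qed.

Lemma generated_sub L (s : seq F) : Defs.subset L (generated L s).
Proof. by move=> a La M _ LM _; apply: LM. Qed.

Lemma generated_gen L (s : seq F) x : x \in s -> generated L s x.
Proof. by move=> sx M _ _; apply. Qed.

(* An embedding of the splitting field N of the minimal polynomial of x restricts to an
   automorphism of N, whether or not F is algebraic over L. *)
Lemma algebraic_moved L x : inv_subring L -> algebraic_over L x -> ~ perfect_closure L x ->
  exists f, Aut L f /\ f x <> x.
Proof.
move=> L_ok alg_x npc; have D_ok := diag_partial_iso L_ok.
have domD a : L a -> pdom (diag L) a by exists a.
have [Q [DQ mQ Qx adj]] := partial_iso_simple D_ok (algebraic_overS domD alg_x).
pose q := map_poly fst Q; have eq : map_poly snd Q = q by rewrite -(diag_fst_snd DQ).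
have mq : q \is monic by apply: monic_map.
have Lq : coefs_in L q by move=> i; rewrite coef_map; case: (DQ i).
have [rs] := closed_field_poly_normal q; rewrite (monicP mq) scale1r => ers.
have rsE y : (y \in rs) = root q y by rewrite ers root_prod_XsubC.
(* Were x the only root, q would be a positive power of X - x with coefficients in L, and x would
   lie in the perfect closure. *)
have [z z_rs zx] : exists2 z, z \in rs & z != x.
  apply/hasP; rewrite -[has _ _]negbK -all_predC; apply/negP => /allP all_x; apply: npc.
  have ers' : rs = nseq (size rs) x.
    by apply/all_pred1P/allP => y /all_x /=; rewrite negbK.
  apply: (@perfect_closure_XsubC_exp _ _ (size rs)) => //.
    by have : x \in rs; [rewrite rsE|case: (rs)].
  by have := Lq; rewrite ers {1}ers' big_nseq iter_mulr_1.
have [|G [G_ok _ adjG maxG]] := @maximal_partial_iso _ False (adjoin (diag L) (x, z)) _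
    (fun h => False_ind _ h).
  by apply: adj; rewrite eq -rsE.
have LG a : L a -> G (a, a) by move=> La; apply/adjG/adjoin_sub => //; case: D_ok.
have GQ : coefs_in G Q.
  by move=> i; have [Qi e] := DQ i; rewrite [Q`_i]surjective_pairing -e; apply: LG.
pose N := generated L rs; have /subfieldP N_ok : is_subfield N := generated_subfield _ _.
have rsG r : r \in rs -> pdom G r.
  rewrite rsE => rr; apply: (pdom_maximal G_ok) => [G' G'_ok|]; first by apply: maxG.
  exists q; split; [exact: monic_neq0|split=> // i; by exists q`_i; apply: LG].
have /boolp.choice[g gE] : forall r, exists b, r \in rs -> G (r, b).
  move=> r; have [/rsG[b Gb]|_] := boolP (r \in rs); first by exists b.
  by exists r.
have g_rs : {in rs, forall r, g r \in rs}.
  by move=> r rr; have := partial_iso_root G_ok GQ (gE r rr); rewrite eq -/q -!rsE => ->.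
have g_inj : {in rs &, injective g}.
  move=> r r' rr rr' e; apply: (partial_iso_inj G_ok (gE r rr)); rewrite e; exact: gE.
(* The restriction of the embedding to N. Being injective, g permutes the roots [rs], so N is both
   its domain and its range. *)
pose G3 w := [/\ G w, N w.1 & N w.2].
have G3_ok : partial_iso G3.
  have [G1 GB GM GV] := G_ok.1.
  have [F1 FB FM FV] := inv_subring_fst N_ok; have [S1 SB SM SV] := inv_subring_snd N_ok.
  split; last by move=> w [Gw _ _]; apply: G_ok.2.
  split; first by [].
  - by move=> a b [Ga a1 a2] [Gb b1 b2]; split; [apply: GB|apply: FB|apply: SB].
  - by move=> a b [Ga a1 a2] [Gb b1 b2]; split; [apply: GM|apply: FM|apply: SM].
  - by move=> a [Ga a1 a2]; split; [apply: GV|apply: FV|apply: SV].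
have LG3 a : L a -> G3 (a, a) by move=> La; split; [apply: LG|apply: generated_sub..].
have Ndom : Defs.subset N (pdom G3).
  move=> a; apply; [exact/subfieldP/pdom_subring|by move=> b Lb; exists b; apply: LG3|].
  by move=> r rr; exists (g r); split; [apply: gE|apply: generated_gen..]; rewrite ?g_rs.
have Nran : Defs.subset N (pran G3).
  move=> a; apply; [exact/subfieldP/pran_subring|by move=> b Lb; exists b; apply: LG3|].
  move=> r rr; have [r' rr' <-] := inj_stable_surj g_inj g_rs rr.
  by exists r'; split; [apply: gE|apply: generated_gen..]; rewrite ?g_rs.
have bal : balanced G3.
  by move=> a; split=> -[b []] /= _ Na Nb; [apply: Nran|apply: Ndom].
have [f [f_aut fE]] := balanced_extends G3_ok bal.
exists f; split; first by split=> // a /LG3/fE.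
have -> : f x = z; last by apply/eqP.
apply: (fE (x, z)); split.
- by apply/adjG/adjoin_gen; case: D_ok.
- by apply: generated_gen; rewrite rsE.
- exact: generated_gen.
Qed.

Lemma perfect_closure_fixed L x : is_subfield L ->
  (perfect_closure L x <-> forall f, Aut L f -> f x = x).
Proof.
move=> L_sub; split.
  move=> pc f [f_aut fL]; have [fD fM f1 _] := f_aut.
  have [phi ephi] := rmorphism_of fD fM f1.
  case: pc => [/fL //|[p [n [charp /fL]]]]; rewrite ephi rmorphXn /= => e.
  (* The p^n-th power map is additive with zero kernel. *)
  apply/eqP; rewrite -subr_eq0.
  have charn : [pchar F].-nat (p ^ n)%N by rewrite pnatX pnatE ?charp // (pcharf_prime charp).
  have : (phi x - x) ^+ (p ^ n) == 0.
    apply/eqP/(addIr (x ^+ (p ^ n))); rewrite -exprDn_pchar // subrK add0r //.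
  by rewrite expf_eq0 => /andP[].
move/subfieldP: L_sub => L_ok fixed; apply: boolp.contrapT => npc.
have [alg_x|trans_x] := boolp.EM (algebraic_over L x).
  by have [f [/fixed]] := algebraic_moved L_ok alg_x npc.
by have [f [/fixed]] := transcendental_moved L_ok trans_x.
Qed.
End Conjugates.

(** * Automorphism groups: closedness and compactness *)

Lemma List_inP (T : eqType) (x : T) (s : seq T) : List.In x s <-> x \in s.
Proof.
elim: s => //= y s IH; rewrite inE; split.
  by case=> [->|/IH ->]; rewrite ?eqxx ?orbT.
by case/orP=> [/eqP ->|/IH]; [left|right].
Qed.

Section Automorphisms.
Variable F : closedFieldType.
Implicit Types (k L : F -> Prop) (H : (F -> F) -> Prop) (f g h : F -> F) (x y : F) (s : seq F).

Lemma Aut_rmorphism L f : Aut L f -> exists phi : {rmorphism F -> F}, f = phi.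
Proof. by case=> [[fD fM f1 _] _]; apply: rmorphism_of. Qed.

Lemma AutS L L' : Defs.subset L L' -> Defs.subset (Aut L') (Aut L).
Proof. by move=> LL' f [f_aut fL]; split=> // x /LL'/fL. Qed.

Lemma Aut_id L : Aut L id.
Proof. by split=> //; split=> //; exists id. Qed.

Lemma Aut_comp L f g : Aut L f -> Aut L g -> Aut L (f \o g).
Proof.
move=> [[fD fM f1 bf] fL] [[gD gM g1 bg] gL]; split; last by move=> x Lx /=; rewrite gL ?fL.
split=> /= [x y|x y||]; rewrite ?gD ?fD ?gM ?fM ?g1 ?f1 //; exact: bij_comp.
Qed.

Lemma Aut_inv L f : Aut L f -> exists g, [/\ Aut L g, cancel f g & cancel g f].
Proof.
move=> [[fD fM f1 [g fK gK]] fL]; exists g; split=> //; split; last first.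
  by move=> x Lx; rewrite -{1}(fL x Lx) fK.
split; last by exists f.
- by move=> x y; apply: (can_inj fK); rewrite fD !gK.
- by move=> x y; apply: (can_inj fK); rewrite fM !gK.
- by apply: (can_inj fK); rewrite f1 gK.
Qed.

Lemma fixed_subfield (A : (F -> F) -> Prop) : (forall f, A f -> is_aut f) ->
  is_subfield (fun x => forall f, A f -> f x = x).
Proof.
move=> A_aut.
have fix_r f : A f -> exists phi : {rmorphism F -> F}, f = phi.
  by case/A_aut=> fD fM f1 _; apply: rmorphism_of.
split=> [f Af|f Af|x y fx fy f Af|x y fx fy f Af|x fx f Af]; have [phi e] := fix_r f Af.
- by rewrite e rmorph0.
- by rewrite e rmorph1.
- by rewrite -[in RHS](fx f Af) -[in RHS](fy f Af) e rmorphB.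
- by rewrite -[in RHS](fx f Af) -[in RHS](fy f Af) e rmorphM.
- by rewrite -[in RHS](fx f Af) e fmorphV.
Qed.

Lemma Aut_generated k s f : Aut k f -> (forall x, x \in s -> f x = x) -> Aut (generated k s) f.
Proof.
move=> [f_aut fk] fs; split=> // x gx.
(* The fixed field of f is written as that of a singleton, to which [fixed_subfield] applies. *)
apply: (gx (fun x => forall g, g = f -> g x = x)) => //.
- by apply: fixed_subfield => g ->.
- by move=> a ka g ->; apply: fk.
- by move=> a sa g ->; apply: fs.
Qed.

Lemma root_Aut L f (q : {poly F}) x : Aut L f -> coefs_in L q -> root q x -> root q (f x).
Proof.
move=> fA Lq /rootP qx; have [phi e] := Aut_rmorphism fA.
have <- : map_poly f q = q.
  by apply/polyP => i; rewrite e coef_map /= -e; apply: fA.2.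
by rewrite e; apply/rootP; rewrite horner_map qx rmorph0.
Qed.

(** In characteristic p one power p^N brings all coefficients of q into L; raising q(x) = 0 to it
    makes x a root of a polynomial in X^(p^N) over L. In characteristic 0 the perfect closure is
    L. *)
Lemma algebraic_perfect_closure L x : inv_subring L ->
  algebraic_over (perfect_closure L) x -> algebraic_over L x.
Proof.
move=> L_ok [q [q0 [Lq /rootP qx]]].
have [[p charp]|nchar] := boolp.EM (exists p, p \in [pchar F]); last first.
  exists q; split=> //; split; last exact/rootP.
  by move=> i; case: (Lq i) => // -[p [n [charp _]]]; case: nchar; exists p.
have /boolp.choice[n Ln] : forall i, exists n, L (q`_i ^+ (p ^ n)).
  move=> i; case: (Lq i) => [Li|[p' [n [charp' Ln]]]]; first by exists 0%N.
  exists n; suff <- : p' = p by [].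
  by move: charp'; rewrite (pcharf_eq charp) inE => /eqP.
pose N := (\max_(i < size q) n i)%N.
have LN i : L (q`_i ^+ (p ^ N)).
  have [lti|lei] := ltnP i (size q); last first.
    rewrite nth_default // expr0n expn_eq0 eqn0Ngt prime_gt0 ?(pcharf_prime charp) //=.
    exact: inv_subring0.
  have le : (n i <= N)%N by apply: (leq_bigmax (Ordinal lti)).
  by rewrite -(subnKC le) expnD exprM; apply: inv_subringX.
have charN : [pchar F].-nat (p ^ N)%N by rewrite pnatX pnatE ?charp // (pcharf_prime charp).
have N0 : (0 < p ^ N)%N by rewrite expn_gt0 prime_gt0 // (pcharf_prime charp).
have [||| phi ephi] := @rmorphism_of F (fun a => a ^+ (p ^ N)).
- by move=> a b; rewrite exprDn_pchar.
- by move=> a b; rewrite exprMn.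
- by rewrite expr1n.
exists (map_poly phi q \Po 'X^(p ^ N)); split; last split.
- by rewrite comp_poly_eq0 ?map_poly_eq0 // size_polyXn ltnS.
- move=> i; rewrite coef_comp_poly_Xn //; case: ifP => _; last exact: inv_subring0.
  by rewrite coef_map /= -ephi.
apply/rootP; rewrite horner_comp hornerXn -[x ^+ _]/((fun a => a ^+ (p ^ N)) x) ephi.
by rewrite horner_map qx rmorph0.
Qed.

(** If f moves an element x of L, so does every g with g x = f x. *)
Lemma Aut_closed k L : Defs.subset k L -> G_closed k (Aut L).
Proof.
move=> kL; split; first exact: AutS.
split; first by move=> f [].
move=> f [fk nfL]; have [nx|/boolp.contrapT[x [Lx fx]]] := boolp.EM (~ exists x, L x /\ f x <> x).
  case: nfL; split; first by case: fk.
  by move=> x Lx; apply: boolp.contrapT => fx; apply: nx; exists x.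
exists [:: x] => g gk gf; split=> // -[_ gL]; apply: fx.
by rewrite -gf ?inE // gL.
Qed.

Definition fin_covered (I : Type) (C : I -> (F -> F) -> Prop) (A : (F -> F) -> Prop) :=
  exists l : list I, forall f, A f -> exists i, List.In i l /\ C i f.

(* The compactness of a product of finite sets, run on the graph of a would-be automorphism:
   a maximal relation through which no finite part of the cover suffices is such a graph. *)
Lemma Aut_compact k L : Defs.subset k L -> algebraic_ext L -> G_compact k (Aut L).
Proof.
move=> kL algL; split=> [|I C Copen Ccov]; first exact: AutS.
apply: boolp.contrapT => ncov.
pose thr (s : seq (F * F)) f := Aut L f /\ forall w, w \in s -> f w.1 = w.2.
pose P (G : F * F -> Prop) := forall s : seq (F * F),
  (forall w, w \in s -> G w) -> ~ fin_covered C (thr s).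
have [||G [GP _ maxG]] := @Zorn_above _ P (fun=> False).
- move=> [|w s] sG [l lC]; last by have := sG w; rewrite inE eqxx => /(_ isT).
  by apply: ncov; exists l => f fA; apply: lC; split.
- move=> D [X0 DX0] DP totD s sD.
  suff [X DX sX] : exists2 X, D X & forall w, w \in s -> X w by apply: (DP X).
  elim: s sD => [|w s IH] sD; first by exists X0.
  have [|X DX sX] := IH; first by move=> v sv; apply: sD; rewrite inE sv orbT.
  have [Y DY Yw] := sD w (mem_head _ _).
  have [XY|YX] := totD _ _ DX DY; [exists Y|exists X] => // v; rewrite inE => /orP[/eqP ->//|sv].
  + exact/XY/sX.
  + exact: YX.
  + exact: sX.
have /boolp.choice[f fG] : forall x, exists y, G (x, y).
  (* If x had no value in G, adding (x, y) to G would produce a finite subcover for each root y of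
     q. As h x is always such a root, these subcovers together would cover some [thr s] with s in
     G. *)
  move=> x; apply: boolp.contrapT => nG; have [q [q0 [Lq qx]]] := algL x.
  have [rs ers] := closed_field_poly_normal q.
  have rsE y : (y \in rs) = root q y.
    by rewrite ers rootZ ?lead_coef_eq0 // root_prod_XsubC.
  suff [s [sG [l lC]]] : exists s : seq (F * F), (forall w, w \in s -> G w) /\
      fin_covered C (fun h => thr s h /\ h x \in rs).
    apply: (GP s sG); exists l => h hs; apply: lC; split=> //.
    by rewrite rsE; apply: (root_Aut hs.1).
  move: {q q0 Lq qx ers rsE} rs; elim=> [|y rs [s [sG [l lC]]]].
    by exists [::]; split=> //; exists [::] => h [].
  have : ~ P (fun w => G w \/ w = (x, y)).
    by move=> GP'; apply: nG; exists y; apply: (maxG _ GP'); [left|right].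
  move/boolp.existsNP => [t /boolp.not_implyP[tG /boolp.contrapT[l' lC']]].
  exists (s ++ [seq w <- t | w != (x, y)]); split.
    move=> w; rewrite mem_cat mem_filter => /orP[/sG //|/andP[/eqP wxy /tG[]//]].
  exists (l ++ l')%list => h [[hA hs]]; rewrite inE => /orP[/eqP hxy|hrs].
    have [|i [li Ci]] := lC' h; last by exists i; split=> //; apply/List.in_app_iff; right.
    split=> // w tw; have [->//|wxy] := eqVneq w (x, y).
    by apply: hs; rewrite mem_cat mem_filter wxy tw orbT.
  have [|i [li Ci]] := lC h; last by exists i; split=> //; apply/List.in_app_iff; left.
  by split=> //; split=> // w sw; apply: hs; rewrite mem_cat sw.
have f_fin s : ~ fin_covered C (fun h => Aut L h /\ forall x, x \in s -> h x = f x).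
  move=> [l lC]; apply: (GP [seq (x, f x) | x <- s]); first by move=> w /mapP[x _ ->].
  exists l => h [hA hs]; apply: lC; split=> // x sx.
  by apply: (hs (x, f x)); apply/mapP; exists x.
(* Otherwise the empty list would be a cover. Identities between finitely many values thus pass from
   such h to f. *)
have f_loc s : exists h, Aut L h /\ forall x, x \in s -> h x = f x.
  apply: boolp.contrapT => nh; apply: (f_fin s); exists [::] => h hA; case: nh.
  by exists h.
have fL x : L x -> f x = x.
  by move=> Lx; have [h [hA <-]] := f_loc [:: x]; rewrite ?inE //; apply: hA.2.
have [|||phi ephi] := @rmorphism_of F f.
- move=> x y; have [h [[[hD _ _ _] _] hE]] := f_loc [:: x; y; x + y].
  by rewrite -!hE ?inE ?eqxx ?orbT.
- move=> x y; have [h [[[_ hM _ _] _] hE]] := f_loc [:: x; y; x * y].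
  by rewrite -!hE ?inE ?eqxx ?orbT.
- by have [h [[[_ _ h1 _] _] <-]] := f_loc [:: 1]; rewrite ?inE.
have fA : Aut L f.
  split=> //; rewrite ephi; apply: is_aut_surjective => y.
  have [q [q0 [Lq qy]]] := algL y; have [rs ers] := closed_field_poly_normal q.
  have rsE z : (z \in rs) = root q z.
    by rewrite ers rootZ ?lead_coef_eq0 // root_prod_XsubC.
  (* Surjectivity: f permutes the finitely many roots of q. *)
  have [|||x _ <-] := @inj_stable_surj _ rs phi _ _ y; last by exists x.
  - by move=> a b _ _; apply: fmorph_inj.
  - move=> a; rewrite !rsE -ephi; have [h [hA <-]] := f_loc [:: a]; rewrite ?inE //.
    exact: root_Aut hA _.
  - by rewrite rsE.
have [i Ci] := Ccov f fA; have [s sC] := (Copen i).2 f Ci.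
apply: (f_fin s); exists [:: i] => h [hA hs]; exists i; split; first by left.
by apply: sC => //; apply: AutS hA.
Qed.

End Automorphisms.

(** * Compact subgroups and their fixed fields *)

Section CompactSubgroups.
Variable F : closedFieldType.
Implicit Types (k L : F -> Prop) (f g h : F -> F) (x y : F) (s : seq F) (p q : {poly F}).

Definition fixed_field (H : (F -> F) -> Prop) : F -> Prop :=
  fun x => forall h, H h -> h x = x.

Lemma map_poly_open k p q : G_open k (fun f => Aut k f /\ map_poly f p = q).
Proof.
split; first by move=> f [].
move=> f [fk fp]; exists p => g gk gf; split=> //; rewrite -fp.
rewrite /map_poly; apply/polyP => i; rewrite !coef_poly; case: ltnP => // lti.
exact/gf/mem_nth.
Qed.

Section OneGroup.
Variables (k : F -> Prop) (H : (F -> F) -> Prop).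
Hypotheses (H_group : G_subgroup k H) (H_cpt : G_compact k H).

Let H_Aut h : H h -> Aut k h. Proof. by case: H_group => + _ _ _; apply. Qed.

(* Letting H act on polynomials turns simultaneous statements about finite families of elements of F
   (coefficient lists) into statements about a single point of the integral domain F[X]. *)
Lemma orbit_polynomial p : exists S : seq {poly F},
  [/\ forall q, q \in S <-> exists2 h, H h & q = map_poly h p &
      forall i j, fixed_field H (\prod_(q <- S) ('X - q%:P))`_i`_j].
Proof.
(* The open sets cut out by the possible images q of p cover H, so compactness leaves finitely many
   images. *)
have [l lC] : exists l : list {poly F}, forall f, H f ->
    exists q, List.In q l /\ Aut k f /\ map_poly f p = q.
  apply: (H_cpt.2 _ (fun q f => Aut k f /\ map_poly f p = q)); first exact: map_poly_open.
  by move=> f Hf; exists (map_poly f p); split; [apply: H_Aut|].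
pose orb q := exists2 h, H h & q = map_poly h p.
pose S := undup [seq q <- l | boolp.asbool (orb q)].
have SE q : q \in S <-> orb q.
  rewrite mem_undup mem_filter; split; first by case/andP=> /boolp.asboolP.
  move=> oq; apply/andP; split; first exact/boolp.asboolP.
  case: oq => h Hh ->; have [q' [lq' [_ ->]]] := lC h Hh.
  exact/List_inP.
exists S; split=> // i j h Hh.
have [phi e] := Aut_rmorphism (H_Aut Hh).
have perm : perm_eq [seq map_poly phi q | q <- S] S.
  have inj : injective (map_poly phi) by apply: map_poly_inj.
  apply: uniq_perm; rewrite ?map_inj_uniq ?undup_uniq //.
  have [|||_ eqS] := @uniq_min_size _ (map (map_poly phi) S) S; last by move=> q; rewrite eqS.
  - by rewrite map_inj_uniq ?undup_uniq.
  - move=> _ /mapP[q /SE[g Hg ->] ->]; apply/SE; exists (h \o g).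
      by case: H_group => _ _ Hcomp _; apply: Hcomp.
    have [psi e'] := Aut_rmorphism (H_Aut Hg).
    by rewrite e e' -map_poly_comp.
  - by rewrite size_map.
have fixP : map_poly (map_poly phi) (\prod_(q <- S) ('X - q%:P)) = \prod_(q <- S) ('X - q%:P).
  rewrite rmorph_prod /= -[RHS](perm_big _ perm) big_map.
  by apply: eq_bigr => q _; rewrite map_polyXsubC.
by rewrite -[in RHS]fixP !coef_map e.
Qed.

Lemma fixed_field_intermediate : intermediate k (fixed_field H).
Proof.
split; first by apply: fixed_subfield => h /H_Aut[].
by move=> x kx h /H_Aut[_ ->].
Qed.

Lemma fixed_field_algebraic : algebraic_ext (fixed_field H).
Proof.
move=> x; have [S [SE fixS]] := orbit_polynomial x%:P.
(* Setting X = 0 in the coefficients turns the orbit polynomial of the constant x into a polynomial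
   over the fixed field. *)
have e : map_poly (horner_eval 0) (\prod_(q <- S) ('X - q%:P)) = \prod_(q <- S) ('X - (q.[0])%:P).
  by rewrite rmorph_prod; apply: eq_bigr => q _; rewrite /= map_polyXsubC.
exists (\prod_(q <- S) ('X - (q.[0])%:P)); split; first exact/monic_neq0/monic_prod_XsubC.
split=> [i|]; first by rewrite -e coef_map /= horner_evalE horner_coef0; apply: fixS.
rewrite -(big_map (fun q : {poly F} => q.[0]) predT (fun a => 'X - a%:P)) root_prod_XsubC.
apply/mapP; exists x%:P; last by rewrite hornerC.
by apply/SE; exists id; [case: H_group|rewrite map_poly_id].
Qed.

(** [Poly s] is a root of its orbit polynomial, whose coefficients g fixes. So g sends it to a root
    again, that is to its image under some h in H, and coefficients can be compared. *)
Lemma compact_subgroup_approx g s : Aut (fixed_field H) g ->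
  exists2 h, H h & {in s, h =1 g}.
Proof.
move=> gA; have [S [SE fixS]] := orbit_polynomial (Poly s).
have [phi e] := Aut_rmorphism gA.
have pS : Poly s \in S.
  by apply/SE; exists id; [case: H_group|rewrite map_poly_id].
have fixP : map_poly (map_poly phi) (\prod_(q <- S) ('X - q%:P)) = \prod_(q <- S) ('X - q%:P).
  apply/polyP => i; apply/polyP => j; rewrite !coef_map /= -e.
  by apply: gA.2; apply: fixS.
have : root (\prod_(q <- S) ('X - q%:P)) (map_poly phi (Poly s)).
  rewrite -fixP; apply/rootP; rewrite horner_map.
  by move: pS; rewrite -root_prod_XsubC => /rootP ->; rewrite rmorph0.
rewrite root_prod_XsubC => /SE[h Hh eh]; exists h => // x xs.
have [psi e'] := Aut_rmorphism (H_Aut Hh).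
have := congr1 (fun q : {poly F} => q`_(index x s)) eh.
by rewrite e' !coef_map /= coef_Poly nth_index // e => ->.
Qed.

(** If g is not in H, the open conditions f x <> g x cover H. A finite subcover gives finitely many
    points at one of which each h in H differs from g, against [compact_subgroup_approx]. *)
Lemma compact_subgroup_Aut : H = Aut (fixed_field H).
Proof.
apply: set_eq_eq => g; split=> [Hg|gA].
  by split; [have [] := H_Aut Hg|move=> x; apply].
apply: boolp.contrapT => nHg.
have [||l lC] := H_cpt.2 F (fun x f => Aut k f /\ f x <> g x).
- move=> x; split; first by move=> f [].
  by move=> f [fk fx]; exists [:: x] => g' g'k g'f; rewrite g'f ?inE.
- move=> f Hf; apply: boolp.contrapT => nx; apply: nHg.
  suff -> : g = f by [].
  apply/boolp.funext => x; apply: boolp.contrapT => fx; apply: nx; exists x.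
  by split; [apply: H_Aut|move=> e; apply: fx].
have [h Hh hg] := compact_subgroup_approx l gA.
by have [x [/List_inP lx [_]]] := lC h Hh; rewrite hg.
Qed.

End OneGroup.

Lemma open_Aut_generated k s L : set_eq L (generated k s) -> G_open k (Aut L).
Proof.
move=> /set_eq_eq ->; split=> [|f [f_aut fL]]; first by apply: AutS; apply: generated_sub.
exists s => g gk gf; apply: Aut_generated => // x xs.
by rewrite gf // fL //; apply: generated_gen.
Qed.

Lemma generatedS k s t : {subset s <= t} -> Defs.subset (generated k s) (generated k t).
Proof. by move=> st x gx M M_ok kM tM; apply: gx => // y /st/tM. Qed.

Lemma generated_min k s L : is_subfield L -> Defs.subset k L -> (forall x, x \in s -> L x) ->
  Defs.subset (generated k s) L.
Proof. by move=> L_ok kL sL x; apply. Qed.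

(** Collecting the coefficients of one polynomial per entry of s allows L to be replaced by a field
    finitely generated over k. *)
Lemma algebraic_coefficients k L s : (forall x, x \in s -> algebraic_over L x) ->
  exists cs, (forall c, c \in cs -> L c) /\
    forall x, x \in s -> algebraic_over (generated k cs) x.
Proof.
elim: s => [|x s IH] alg; first by exists [::].
have [|cs [csL csE]] := IH; first by move=> y ys; apply: alg; rewrite inE ys orbT.
have [q [q0 [Lq qx]]] := alg x (mem_head _ _); exists (q ++ cs); split.
  by move=> c; rewrite mem_cat => /orP[/(nthP 0)[i _ <-]|/csL].
move=> y; rewrite inE => /orP[/eqP ->|ys]; last first.
  apply: algebraic_overS (csE y ys); apply: generatedS => c; rewrite mem_cat => ->; exact: orbT.
exists q; split=> //; split=> // i; have [lti|lei] := ltnP i (size q).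
  by apply: generated_gen; rewrite mem_cat mem_nth.
by rewrite nth_default //; case: (generated_subfield k (q ++ cs)).
Qed.

(** Each g x is among the roots of one fixed polynomial over L that vanishes at x. *)
Lemma Aut_finite_values L s : (forall x, x \in s -> algebraic_over L x) ->
  exists vs : seq (seq F), forall g, Aut L g -> map g s \in vs.
Proof.
elim: s => [|x s IH] alg; first by exists [:: [::]] => g _; rewrite inE.
have [|vs vsE] := IH; first by move=> y ys; apply: alg; rewrite inE ys orbT.
have [q [q0 [Lq qx]]] := alg x (mem_head _ _).
have [rs ers] := closed_field_poly_normal q.
exists [seq y :: v | y <- rs, v <- vs] => g gA /=; apply: allpairs_f (vsE g gA).
by have := root_Aut gA Lq qx; rewrite {1}ers rootZ ?lead_coef_eq0 // root_prod_XsubC.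
Qed.

(* Aut(F|k(cs)) meets only finitely many cosets of H, and each coset other than H is
   excluded by adjoining one element of the fixed field of H. *)
Lemma compact_open_fin_gen k (H : (F -> F) -> Prop) :
  G_subgroup k H -> G_compact k H -> G_open k H ->
  exists L, [/\ intermediate k L, fin_gen k L, algebraic_ext L & set_eq H (Aut L)].
Proof.
move=> H_group H_cpt H_open; pose L := fixed_field H.
have [L_sub kL] : intermediate k L := fixed_field_intermediate H_group.
have HE : H = Aut L := compact_subgroup_Aut H_group H_cpt.
have algL : algebraic_ext L := fixed_field_algebraic H_group H_cpt.
have [s sH] : exists s, forall g, Aut k g -> (forall x, x \in s -> g x = x) -> H g.
  by case: H_group => _ Hid _ _; apply: H_open.2 Hid.
have [cs [csL csE]] := @algebraic_coefficients k L s (fun x _ => algL x).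
have [vs vsE] := Aut_finite_values csE.
(* Two automorphisms with the same values v on s lie in one coset of H and agree on L, so an element
   of L moved by one of them is moved by the other. The default 0 serves when no g outside H has the
   values v. *)
have /boolp.choice[w wE] : forall v, exists x, L x /\
    forall g, Aut k g -> map g s = v -> ~ H g -> g x <> x.
  move=> v; have [[g0 [g0k g0v nHg0]]|no] :=
      boolp.EM (exists g, [/\ Aut k g, map g s = v & ~ H g]); last first.
    exists 0; split; first by case: L_sub.
    by move=> g gk gv nHg; case: no; exists g.
  have [x [Lx g0x]] : exists x, L x /\ g0 x <> x.
    apply: boolp.contrapT => nx; apply: nHg0; rewrite HE; split; first by case: g0k.
    by move=> x Lx; apply: boolp.contrapT => g0x; apply: nx; exists x.
  exists x; split=> // g gk gv _ gx; apply: g0x.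
  have [g0' [g0'k g0K g0'K]] := Aut_inv g0k.
  have : H (g0' \o g).
    apply: sH => [|y ys /=]; first exact: Aut_comp.
    rewrite -[RHS]g0K; congr g0'.
    by move: gv; rewrite -g0v => /eq_in_map; apply.
  by rewrite HE => -[_ /(_ x Lx) /= e]; rewrite -[in LHS]e g0'K.
pose ws := cs ++ map w vs.
have L1L : Defs.subset (generated k ws) L.
  apply: generated_min => // c; rewrite mem_cat => /orP[/csL//|/mapP[v _ ->]].
  by case: (wE v).
have HE1 : H = Aut (generated k ws).
  apply: set_eq_eq => g; split=> [|gA]; first by rewrite HE; apply: AutS.
  have gk : Aut k g by apply: AutS gA; apply: generated_sub.
  apply: boolp.contrapT => nHg.
  have [_ /(_ g gk erefl nHg)] := wE (map g s); apply; apply: gA.2; apply: generated_gen.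
  rewrite mem_cat map_f ?orbT //; apply: vsE; apply: AutS gA; apply: generatedS.
  by move=> c; rewrite mem_cat => ->.
exists (generated k ws); split.
- by split; [apply: generated_subfield|apply: generated_sub].
- by exists ws.
(* L is fixed by H = Aut(F|k(ws)), so it lies in the perfect closure of k(ws), and F is algebraic
   over L. *)
- move=> x; apply: algebraic_perfect_closure; first exact/subfieldP/generated_subfield.
  apply: algebraic_overS (algL x) => y Ly.
  apply/perfect_closure_fixed; first exact: generated_subfield.
  by rewrite -HE1.
- by rewrite -HE1.
Qed.

End CompactSubgroups.

Theorem mainTheorem7 (F : closedFieldType) (k : F -> Prop) (hk : is_subfield k) :
  (* (1) Aut(F|L) is a closed subgroup; Aut(F|L1) = Aut(F|L2) iff L1^i = L2^i *)
  (forall L, intermediate k L -> G_subgroup k (Aut L) /\ G_closed k (Aut L)) /\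
  (forall L1 L2, intermediate k L1 -> intermediate k L2 ->
     (set_eq (Aut L1) (Aut L2) <-> set_eq (perfect_closure L1) (perfect_closure L2))) /\
  (* (2) F|L algebraic  <->  compact subgroups *)
  (forall L, intermediate k L -> algebraic_ext L -> G_compact k (Aut L)) /\
  (forall H, G_subgroup k H -> G_compact k H ->
     exists L, [/\ intermediate k L, algebraic_ext L & set_eq H (Aut L)]) /\
  (* (3) L finitely generated over k and F|L algebraic  <->  compact open subgroups *)
  (forall L, intermediate k L -> fin_gen k L -> algebraic_ext L ->
     G_compact k (Aut L) /\ G_open k (Aut L)) /\
  (forall H, G_subgroup k H -> G_compact k H -> G_open k H ->
     exists L, [/\ intermediate k L, fin_gen k L, algebraic_ext L & set_eq H (Aut L)]).
Proof.
split; [|split; [|split; [|split; [|split]]]].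
- move=> L [_ kL]; split; last exact: Aut_closed.
  split; first exact: AutS.
  + exact: Aut_id.
  + by move=> f g; apply: Aut_comp.
  + by move=> f /Aut_inv[g [gA fK gK]]; exists g.
- move=> L1 L2 [L1_sub _] [L2_sub _]; split=> [/set_eq_eq e x|e f].
    by rewrite !perfect_closure_fixed // e.
  have pcA L : is_subfield L -> Aut L f <-> is_aut f /\ forall x, perfect_closure L x -> f x = x.
    move=> L_sub; split=> [fA|[f_aut fpc]]; last by split=> // x Lx; apply: fpc; left.
    by split=> [|x /perfect_closure_fixed]; [case: fA|apply].
  by rewrite !pcA //; split=> -[f_aut fpc]; split=> // x /e; apply: fpc.
- by move=> L [_ kL]; apply: Aut_compact.
- move=> H H_group H_cpt; exists (fixed_field H); split.
  + exact: fixed_field_intermediate.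
  + exact: fixed_field_algebraic H_group H_cpt.
  + by rewrite -(compact_subgroup_Aut H_group H_cpt).
- move=> L [_ kL] [s Ls] algL; split; first exact: Aut_compact.
  exact: open_Aut_generated Ls.
- by move=> H; apply: compact_open_fin_gen.
Qed.
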